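(* Let $R=(r_1,r_2,\ldots,r_n)$ be a $2$-nearly nondecreasing vector of nonnegative integers. Then $R$ is the score vector of a tournament if and only if $$\sum_{i=1}^k r_i\ge \binom{k}{2}\quad (k=1,2,\ldots,n),\ \mbox{ with equality if } k=n.$$
   Context: A tournament of order $n$ is an $n\times n$ $(0,1)$-matrix $T=[t_{ij}]$ with $t_{ii}=0$ for all $i$ and $t_{ij}=1-t_{ji}$ for $i\ne j$. Its score vector is $R=(r_1,\ldots,r_n)$ where $r_i$ is the $i$th row sum of $T$. For a nonnegative integer $k$, a vector $R=(r_1,\ldots,r_n)$ is $k$-nearly nondecreasing provided there is a vector $u=(u_1,\ldots,u_n)$ with entries in $\{0,1,\ldots,k\}$ such that $R-u$ is nondecreasing; equivalently, $r_j\ge r_i-k$ for $1\le i<j\le n$. *)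

(* Defs.v *)
From mathcomp Require Import all_boot all_order all_algebra.

Set Implicit Arguments.
Unset Strict Implicit.
Unset Printing Implicit Defensive.

Import Order.TTheory GRing.Theory Num.Theory.
Local Open Scope ring_scope.

(* Matrices and vectors are taken over [int], so that the
   differences 1 - t_ji and R - u are genuine, not truncated, subtractions. *)

Definition is_tournament (n : nat) (T : 'M[int]_n) : Prop :=
  [/\ forall i j : 'I_n, T i j = 0 \/ T i j = 1,
      forall i : 'I_n, T i i = 0
    & forall i j : 'I_n, i != j -> T i j = 1 - T j i].

Definition score_vector (n : nat) (T : 'M[int]_n) : 'rV[int]_n :=
  \row_(i < n) \sum_(j < n) T i j.

Definition nondecreasing_vector (n : nat) (v : 'rV[int]_n) : Prop :=
  forall i j : 'I_n, (i <= j)%N -> v 0 i <= v 0 j.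

Definition nearly_nondecreasing (k n : nat) (R : 'rV[int]_n) : Prop :=
  exists2 u : 'rV[int]_n,
    forall i : 'I_n, 0 <= u 0 i <= k%:Z
    & nondecreasing_vector (R - u).

(* Main.v *)
Require Import Defs.
From mathcomp Require Import all_boot all_order all_algebra.
From mathcomp Require Import zify ring lra.

(** Necessity is a double count: the games played inside a set of [k] players
    distribute 'C(k, 2) wins, and the remaining games can only add to the total
    score of the set ([sum_score_split]).

    Sufficiency combines two facts.  First, for a vector whose entries never
    drop by more than 2 from left to right, the inequalities on initial segments
    imply the inequality for every set [A] of players ([prefix_to_subset]).
    Let [x] be the last player of [A].  If [R x >= #|A| - 1], remove [x] and
    induct, since 'C(k, 2) = 'C(k - 1, 2) + (k - 1).  Otherwise
    [R x <= #|A| - 2], so every player before [x] has [R <= #|A|]; the [b]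
    players before [x] and outside [A] then account for at most [b * #|A|] in
    the initial segment ending at [x], and
    'C(#|A| + b, 2) - b * #|A| = 'C(#|A|, 2) + 'C(b, 2).
    This is where the constant 2 is used, with no slack.

    Second, the inequalities on all sets, with equality for the full set,
    suffice ([landau]).  Start from any tournament and decrease the distance
    from its scores to [R].  A player [x] whose score is too large must reach,
    along winning arcs, a player [y] whose score is too small: otherwise the set
    of players reachable from [x] would win no game against the outside, so its
    total score would be exactly the binomial coefficient, yet exceed the total
    of [R] ([deficit_reachable]).  Reversing a simple path from [x] to [y] moves
    one win from [x] to [y] and changes no other score ([reverse_path]). *)

Set Implicit Arguments.
Unset Strict Implicit.
Unset Printing Implicit Defensive.

Import Order.TTheory GRing.Theory Num.Theory.
Local Open Scope ring_scope.

Lemma bin2_int (m : nat) : 'C(m, 2)%:Z *+ 2 = m%:Z * (m%:Z - 1).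
Proof.
elim: m => [|m IH]; first by rewrite mul0r.
by rewrite binS bin1 PoszD mulrnDl IH; lia.
Qed.

Lemma bin2D (a b : nat) : 'C(a + b, 2) = ('C(a, 2) + 'C(b, 2) + a * b)%N.
Proof.
by elim: a => [|a IH]; rewrite ?addn0 // addSn !binS !bin1 IH mulSn; lia.
Qed.

(** Adding the double sum to its transpose makes every off-diagonal pair
    contribute 1. *)
Lemma sum_tournament_block (n : nat) (T : 'M[int]_n) (A : {set 'I_n}) :
  is_tournament T ->
  \sum_(i in A) \sum_(j in A) T i j = 'C(#|A|, 2)%:Z.
Proof.
move=> [_ T_diag T_skew]; apply: (@mulIf _ 2) => //.
rewrite !mulr_natr bin2_int mulr2n [X in _ + X]exchange_big /= -big_split /=.
have row_sum (i : 'I_n) : i \in A ->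
    \sum_(j in A) T i j + \sum_(j in A) T j i = #|A|%:Z - 1.
  move=> iA; rewrite -big_split (bigD1 i) //= !T_diag !add0r.
  rewrite (eq_bigr (fun=> 1)) => [|j /andP[_ neq_ji]]; last first.
    by rewrite (T_skew i j) 1?eq_sym // addrNK.
  rewrite (cardsD1 i) iA sumr_const /= -cardsE.
  have -> : [set j in A | j != i] = A :\ i.
    by apply/setP=> j; rewrite !inE andbC.
  by rewrite PoszD addrAC subrr add0r natz.
by rewrite (eq_bigr _ row_sum) sumr_const -mulr_natl natz.
Qed.

(** Wins of a set of players, split into wins inside and wins against the
    outside.  Nonnegativity of the last term gives necessity; its vanishing for
    a set whose players beat nobody outside is what [deficit_reachable] needs. *)
Lemma sum_score_split (n : nat) (T : 'M[int]_n) (A : {set 'I_n}) :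
  is_tournament T ->
  \sum_(i in A) score_vector T 0 i
    = 'C(#|A|, 2)%:Z + \sum_(i in A) \sum_(j in ~: A) T i j.
Proof.
move=> tT; rewrite -(sum_tournament_block A tT) -big_split /=.
apply: eq_bigr => i _; rewrite mxE (bigID (mem A)) /=.
by congr (_ + _); apply: eq_bigl => j; rewrite inE.
Qed.

Lemma sum_score_ge (n : nat) (T : 'M[int]_n) (A : {set 'I_n}) :
  is_tournament T -> 'C(#|A|, 2)%:Z <= \sum_(i in A) score_vector T 0 i.
Proof.
move=> tT; rewrite sum_score_split // lerDl.
apply: sumr_ge0 => i _; apply: sumr_ge0 => j _.
by case: tT => /(_ i j) [] ->.
Qed.

Lemma sum_score_all (n : nat) (T : 'M[int]_n) :
  is_tournament T -> \sum_i score_vector T 0 i = 'C(n, 2)%:Z.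
Proof.
move=> tT; have := sum_tournament_block setT tT; rewrite cardsT card_ord => <-.
apply: eq_big => [i|i _]; first by rewrite inE.
by rewrite mxE; apply: eq_bigl => j; rewrite inE.
Qed.

(** The transitive tournament, in which each player beats all earlier ones. *)
Lemma exists_tournament (n : nat) : exists T : 'M[int]_n, is_tournament T.
Proof.
exists (\matrix_(i, j) (j < i)%N%:Z); split=> [i j|i|i j neq_ij]; rewrite !mxE.
- by case: (j < i)%N; [right | left].
- by rewrite ltnn.
- by move: neq_ij; rewrite -val_eqE /=; case: ltngtP.
Qed.

(** Reversing an arc is written as a matrix addition so that its effect on the
    scores follows from linearity alone. *)
Lemma score_reverse_arc (n : nat) (T : 'M[int]_n) (x y : 'I_n) :
  score_vector (T - delta_mx x y + delta_mx y x)
    = score_vector T - delta_mx 0 x + delta_mx 0 y.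
Proof.
apply/rowP=> i; rewrite !mxE /=.
under eq_bigr do rewrite !mxE.
rewrite big_split sumrB /=.
have sum_delta (a b : 'I_n) :
    \sum_(j < n) ((i == a) && (j == b))%:R = (i == a)%:R :> int.
  rewrite (bigD1 b) //= eqxx andbT big1 ?addr0 // => j /negPf ->.
  by rewrite andbF.
by rewrite !sum_delta.
Qed.

Lemma tournament_reverse_arc (n : nat) (T : 'M[int]_n) (x y : 'I_n) :
  is_tournament T -> T x y = 1 ->
  is_tournament (T - delta_mx x y + delta_mx y x).
Proof.
move=> [T01 T_diag T_skew] Txy.
have neq_xy : x != y by apply/eqP=> eq_xy; move: Txy; rewrite eq_xy T_diag.
have Tyx : T y x = 0 by rewrite T_skew 1?eq_sym // Txy.
split=> [i j|i|i j neq_ij]; rewrite !mxE.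
- have [/andP[/eqP -> /eqP ->]|_] := boolP ((i == x) && (j == y)).
    by left; rewrite Txy (negPf neq_xy).
  have [/andP[/eqP -> /eqP ->]|_] := boolP ((i == y) && (j == x)).
    by right; rewrite Tyx.
  by rewrite subr0 addr0.
- rewrite T_diag; case: (eqVneq i x) => [->|_]; last by rewrite andbF.
  by rewrite (negPf neq_xy).
- by rewrite (T_skew _ _ neq_ij) ![(j == _) && _]andbC; ring.
Qed.

(** Arcs are reversed one at a time from [x]: each reversal hands the win on to
    the next vertex, so the contributions of interior vertices telescope.
    Simplicity of the path ensures that reversing its first arc leaves the
    remaining ones intact. *)
Lemma reverse_path (n : nat) (p : seq 'I_n) (T : 'M[int]_n) (x : 'I_n) :
  is_tournament T -> path (fun i j => T i j == 1) x p -> uniq (x :: p) ->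
  exists2 T' : 'M[int]_n, is_tournament T' &
    score_vector T' = score_vector T - delta_mx 0 x + delta_mx 0 (last x p).
Proof.
elim: p T x => [|y p IHp] T x tT /=; first by exists T; rewrite ?addrNK.
move=> /andP[/eqP Txy path_p] /andP[x_notin uniq_yp].
have [|T' tT' sT'] := IHp _ y (tournament_reverse_arc tT Txy) _ uniq_yp.
- (* The entries changed by the reversal all involve [x]. *)
  apply: (sub_in_path (P := mem (y :: p))) path_p; last exact/allP.
  move=> i j iyp jyp.
  have i_neq_x : i != x by apply: contraNneq x_notin => <-.
  have j_neq_x : j != x by apply: contraNneq x_notin => <-.
  by rewrite !mxE (negPf i_neq_x) (negPf j_neq_x) andbF subr0 addr0.
- by exists T' => //; rewrite sT' score_reverse_arc addrK.
Qed.

(** If all players reachable from [x] had at least their prescribed score, the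
    reachable set would violate its inequality: its players beat nobody outside
    it, so its total score is minimal, and [x] makes that total exceed the
    prescribed one. *)
Lemma deficit_reachable (n : nat) (R : 'rV[int]_n) (T : 'M[int]_n) (x : 'I_n) :
  (forall A : {set 'I_n}, 'C(#|A|, 2)%:Z <= \sum_(i in A) R 0 i) ->
  is_tournament T -> R 0 x < score_vector T 0 x ->
  exists2 y, connect (fun i j => T i j == 1) x y & score_vector T 0 y < R 0 y.
Proof.
move=> R_ge tT x_exc; set e := (fun i j => T i j == 1).
case: (pickP [pred y | connect e x y && (score_vector T 0 y < R 0 y)]) => [y|no].
  by move=> /andP[]; exists y.
pose A := [set y | connect e x y].
have xA : x \in A by rewrite inE connect0.
have lt_sums : \sum_(i in A) R 0 i < \sum_(i in A) score_vector T 0 i.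
  rewrite (bigD1 x) //= [ltRHS](bigD1 x) //=.
  apply: ltr_leD => //; apply: ler_sum => i /andP[iA _].
  by have := no i; rewrite /= -[connect e x i]in_set iA leNgt => /= ->.
suff closedA : \sum_(i in A) score_vector T 0 i = 'C(#|A|, 2)%:Z.
  by have := R_ge A; rewrite -closedA leNgt lt_sums.
(* A player of [A] cannot beat one outside, who would then be reachable. *)
rewrite sum_score_split // big1 ?addr0 // => i iA; rewrite big1 // => j.
rewrite !inE in iA *; apply: contraNeq => Tij.
apply: connect_trans iA _; apply: connect1; rewrite /e.
by case: tT => /(_ i j) [] Tij'; rewrite Tij' ?eqxx // in Tij *.
Qed.

Lemma dist_transfer (n : nat) (R s : 'rV[int]_n) (x y : 'I_n) :
  R 0 x < s 0 x -> s 0 y < R 0 y ->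
  \sum_i `|(s - delta_mx 0 x + delta_mx 0 y) 0 i - R 0 i| + 2
    = \sum_i `|s 0 i - R 0 i|.
Proof.
move=> x_exc y_def.
have neq_yx : y != x by apply: contraTneq y_def => ->; rewrite -leNgt ltW.
rewrite (bigD1 x) //= (bigD1 y) //= [RHS](bigD1 x) //= [X in _ = _ + X](bigD1 y) //=.
rewrite (eq_bigr (fun i => `|s 0 i - R 0 i|)) => [|i /andP[i_x i_y]]; last first.
  by rewrite !mxE (negPf i_x) (negPf i_y) subr0 addr0.
rewrite !mxE !eqxx [x == y]eq_sym (negPf neq_yx) /=.
move: x_exc y_def; lia.
Qed.

(** Landau's theorem, in the form without any ordering of the players.  The
    induction is on the l1-distance from the scores of the current tournament
    to [R], which each path reversal lowers by 2 ([dist_transfer]). *)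
Theorem landau (n : nat) (R : 'rV[int]_n) :
  (forall A : {set 'I_n}, 'C(#|A|, 2)%:Z <= \sum_(i in A) R 0 i) ->
  \sum_i R 0 i = 'C(n, 2)%:Z ->
  exists2 T : 'M[int]_n, is_tournament T & R = score_vector T.
Proof.
move=> R_ge R_all; have [T tT] := exists_tournament n.
have [m] := ubnP `|(\sum_i `|score_vector T 0 i - R 0 i|)%R|%N.
elim: m T tT => // m IHm T tT lt_m.
case: (pickP [pred x | R 0 x < score_vector T 0 x]) => [x /= x_exc|no_exc].
- have [y /connectP[p path_p def_y] y_def] := deficit_reachable R_ge tT x_exc.
  case/shortenP: path_p def_y => p' path_p' uniq_p' _ def_y.
  have [T' tT' sT'] := reverse_path tT path_p' uniq_p'.
  rewrite -def_y in sT'.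
  apply: (IHm T' tT'); rewrite sT'.
  have T'_ge0 : 0 <= \sum_i
      `|(score_vector T - delta_mx 0 x + delta_mx 0 y) 0 i - R 0 i|.
    by apply: sumr_ge0.
  rewrite -(dist_transfer x_exc y_def) in lt_m.
  by move: T'_ge0 lt_m; set d := \sum_i _; lia.
- (* No score is in excess, and the totals agree, so all scores agree. *)
  exists T => //; apply/rowP=> i; apply/eqP; rewrite -subr_eq0; apply/eqP.
  have /psumr_eq0P -> // : \sum_i (R 0 i - score_vector T 0 i) = 0.
    by rewrite sumrB R_all sum_score_all // subrr.
  by move=> j _; rewrite subr_ge0 leNgt; apply/negbT/no_exc.
Qed.

Lemma card_prefix (n k : nat) : (k <= n)%N -> #|[set i : 'I_n | (i < k)%N]| = k.
Proof.
move=> le_kn; rewrite -sum1_card; under eq_bigl do rewrite inE.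
by rewrite -(big_ord_widen n (fun=> 1%N) le_kn) sum1_card card_ord.
Qed.

Lemma nearly_nondecreasing_drop (k n : nat) (R : 'rV[int]_n) :
  nearly_nondecreasing k R ->
  forall i j : 'I_n, (i <= j)%N -> R 0 i <= R 0 j + k%:Z.
Proof.
move=> [u u_bd mono] i j /mono; rewrite !mxE.
have /andP[_ ui_le] := u_bd i; have /andP[uj_ge _] := u_bd j; lra.
Qed.

(** By induction on [#|A|]: if the last player [x] of [A] has a score of at
    least [#|A| - 1], it is removed; if not, [A] is compared with the initial
    segment ending at [x], where the players outside [A] have at most [#|A|]
    each. *)
Lemma prefix_to_subset (n : nat) (R : 'rV[int]_n) :
  (forall i j : 'I_n, (i <= j)%N -> R 0 i <= R 0 j + 2) ->
  (forall k : nat, (1 <= k <= n)%N ->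
     'C(k, 2)%:Z <= \sum_(i < n | (i < k)%N) R 0 i) ->
  forall A : {set 'I_n}, 'C(#|A|, 2)%:Z <= \sum_(i in A) R 0 i.
Proof.
move=> drop2 prefix_ge A; have [m] := ubnP #|A|.
elim: m A => // m IHm A lt_m.
have [->|[a aA]] := set_0Vmem A; first by rewrite cards0 big_set0.
case: (arg_maxnP (fun i : 'I_n => val i) aA) => x xA x_max.
have cardA : #|A| = #|A :\ x|.+1 by rewrite (cardsD1 x) (_ : x \in A).
have [x_big|x_small] := lerP #|A :\ x|%:Z (R 0 x).
  rewrite (big_setD1 x) //= cardA binS bin1 PoszD addrC.
  by apply: lerD => //; apply: IHm; rewrite cardA in lt_m.
pose P := [set i : 'I_n | (i < x.+1)%N].
have subAP : A \subset P by apply/subsetP=> i /x_max; rewrite inE.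
have cardP : #|P| = x.+1 by apply: card_prefix.
have := prefix_ge x.+1; rewrite ltn_ord => /(_ isT).
rewrite (eq_bigl (mem P)) => [|i]; last by rewrite !inE.
rewrite -cardP.
rewrite (big_setID A) /= (setIidPr subAP).
have : \sum_(i in P :\: A) R 0 i <= \sum_(i in P :\: A) #|A|%:Z.
  apply: ler_sum => i; rewrite !inE => /andP[_ le_ix].
  by have := drop2 i x le_ix; lia.
rewrite sumr_const -mulr_natl natz.
have := cardsID A P; rewrite (setIidPr subAP) => <-.
rewrite bin2D !PoszD PoszM mulrC.
have : 0 <= 'C(#|P :\: A|, 2)%:Z by [].
lra.
Qed.

Theorem theorem5 (n : nat) (R : 'rV[int]_n)
    (R_ge0 : forall i : 'I_n, 0 <= R 0 i)
    (R_2nn : nearly_nondecreasing 2 R) :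
  (exists2 T : 'M[int]_n, is_tournament T & R = score_vector T) <->
  (forall k : nat, (1 <= k <= n)%N ->
     'C(k, 2)%:Z <= \sum_(i < n | (i < k)%N) R 0 i
     /\ (k = n -> \sum_(i < n | (i < k)%N) R 0 i = 'C(k, 2)%:Z)).
Proof.
split=> [[T tT ->] k /andP[_ le_kn] | R_prefix].
- split=> [|->].
    have := sum_score_ge [set i : 'I_n | (i < k)%N] tT.
    by rewrite card_prefix //; under eq_bigl do rewrite inE.
  by rewrite -(sum_score_all tT); apply: eq_bigl => i; rewrite ltn_ord.
- apply: landau.
    apply: prefix_to_subset; first exact: nearly_nondecreasing_drop.
    by move=> k /R_prefix[].
  (* With no player, the hypothesis on [k] is void and both sides are 0. *)
  case: n => [|n] in R R_ge0 R_2nn R_prefix *; first by rewrite big_ord0.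
  have [|_ <- //] := R_prefix n.+1; first exact: leqnn.
  by apply: eq_bigl => i; rewrite ltn_ord.
Qed.
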